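(* Let $\mathbf{A}\in\mathbb{R}^{m\times r}$ and $\mathbf{B}\in\mathbb{R}^{r\times n}$ be independent random matrices whose entries are independently and identically distributed according to the standard normal distribution (mean zero and variance one). Then the expected value of the squared Frobenius norm of their product is $$\mathbb{E}\left(\|\mathbf{A}\mathbf{B}\|_F^2\right)=mnr.$$
   Context: $\|\cdot\|_F$ denotes the Frobenius norm. *)

(* Defs.v *)
From HB Require Import structures.
From mathcomp Require Import all_boot all_order all_algebra.
From mathcomp Require Import all_classical all_reals all_analysis.

Set Implicit Arguments.
Unset Strict Implicit.
Unset Printing Implicit Defensive.

Import Order.TTheory GRing.Theory Num.Theory.
Import numFieldNormedType.Exports.

Local Open Scope classical_set_scope.
Local Open Scope ring_scope.

Definition frobenius_norm (R : realType) (p q : nat) (M : 'M[R]_(p, q)) : R :=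
  Num.sqrt (\sum_i \sum_j `|M i j| ^+ 2).

Section RandomMatrices.
Context (d : measure_display) (T : measurableType d) (R : realType)
  (P : probability T R).

(* A map into 'M[R]_(p, q) is Borel measurable iff each of its entries is, so a
   random matrix is encoded as a matrix of real random variables. *)
Definition random_matrix (p q : nat) := 'M[{RV P >-> R}]_(p, q).

Definition mx_value (p q : nat) (A : random_matrix p q) (w : T) : 'M[R]_(p, q) :=
  \matrix_(i < p, j < q) A i j w.

Definition mutually_independent (I : finType) (X : I -> {RV P >-> R}) : Prop :=
  forall (J : {set I}) (U : I -> set R), (forall i, measurable (U i)) ->
    P (\bigcap_(i in [set` J]) X i @^-1` U i) =
      (\prod_(i in J) P (X i @^-1` U i))%E.

(* The law is compared on measurable sets only: outside them the value of a
   measure is unspecified. *)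
Definition standard_normal (X : {RV P >-> R}) : Prop :=
  forall U : set R, measurable U -> distribution P X U = normal_prob 0 1 U.

Definition iid_standard_normal (p q : nat) (A : random_matrix p q) : Prop :=
  mutually_independent (fun ij : 'I_p * 'I_q => A ij.1 ij.2) /\
  forall i j, standard_normal (A i j).

(* The sigma-algebra on T generated by the random matrix A, that is, by its
   entries. *)
Definition mx_sigma_algebra (p q : nat) (A : random_matrix p q) : set (set T) :=
  <<s [set E | exists i j, preimage_set_system setT (A i j) measurable E] >>.

Definition independent_mx (p q p' q' : nat)
    (A : random_matrix p q) (B : random_matrix p' q') : Prop :=
  forall E F : set T, mx_sigma_algebra A E -> mx_sigma_algebra B F ->
    P (E `&` F) = (P E * P F)%E.

End RandomMatrices.

(* Main.v *)
(** The expansion of the squared norm of [A *m B] is the sum over [i, j, k, l] of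
    [A i k * A i l * (B k j * B l j)]. By independence of [A] and [B] each term
    has expectation ['E(A i k * A i l) * 'E(B k j * B l j)], which is 1 if
    [k = l] and 0 otherwise, because distinct entries are independent with mean 0
    and all entries have second moment 1; [m * n * r] terms remain.
    Products of independent variables are handled by Fubini's theorem for the
    joint law. The second moment of the standard normal density [phi] comes from
    the antiderivative of [x ^+ 2 * phi x] on the positive half-line given by the
    integral of [phi] minus [x * phi x]. *)

Require Import Defs.
From HB Require Import structures.
From mathcomp Require Import all_boot all_order all_algebra.
From mathcomp Require Import all_classical all_reals all_analysis.
From mathcomp Require Import measurable_realfun.
From mathcomp Require Import ring lra.

Set Implicit Arguments.
Unset Strict Implicit.
Unset Printing Implicit Defensive.

Import Order.TTheory GRing.Theory Num.Theory.
Import numFieldNormedType.Exports.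

Local Open Scope classical_set_scope.
Local Open Scope ring_scope.
Import gauss_integral_proof.

(** * Moments of the standard normal law *)

Section normal_moments.
Context {R : realType}.
Local Notation mu := (@lebesgue_measure R).
Local Notation phi := (@normal_pdf R 0 1).

(** The Radon-Nikodym derivative of [normal_prob m s] and the density [normal_pdf m s] have the same
    integral over every measurable set, so they agree almost everywhere. *)
Lemma ge0_integral_normal_prob (m s : R) (f : R -> \bar R) :
    measurable_fun [set: R] f -> (forall x, 0 <= f x)%E ->
  (\int[normal_prob m s]_x f x = \int[mu]_x (f x * (normal_pdf m s x)%:E))%E.
Proof.
move=> mf f0; have dom := normal_prob_dominates m s.
rewrite -(Radon_Nikodym_SigmaFinite.change_of_variables dom f0)//.
have iRN := Radon_Nikodym_SigmaFinite.f_integrable dom.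
apply: ae_eq_integral => //.
- by apply: emeasurable_funM => //; exact: measurable_int iRN.
- apply: emeasurable_funM => //; apply/measurable_EFinP.
  exact: measurable_normal_pdf.
- apply: ae_eqe_mul2l; apply: integral_ae_eq => //.
  + by apply/measurable_EFinP; exact: measurable_normal_pdf.
  + by move=> E _ mE; rewrite -Radon_Nikodym_SigmaFinite.f_integral.
Qed.

Lemma normal_pdf_gauss_fun x :
  phi x = (Num.sqrt (pi *+ 2))^-1 * gauss_fun (x / Num.sqrt 2).
Proof.
rewrite normal_pdfE ?oner_neq0// /normal_peak /normal_fun /gauss_fun.
rewrite expr1n mul1r; congr (_ * expR _).
by rewrite subr0 exprMn exprVn sqr_sqrtr// mulNr.
Qed.

Lemma normal_pdfN x : phi (- x) = phi x.
Proof. by rewrite !normal_pdf_gauss_fun /gauss_fun mulNr sqrrN. Qed.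

Lemma is_derive_normal_pdf (x : R) : is_derive x 1 phi (- x * phi x).
Proof.
rewrite (funext normal_pdf_gauss_fun) /gauss_fun.
apply: is_derive_eq.
rewrite /GRing.scale/= !(mulr0, addr0, add0r, mulr1).
have -> : (Num.sqrt 2 : R)^-1 = Num.sqrt 2 / 2.
  have s20 : Num.sqrt 2 != 0 :> R by rewrite sqrtr_eq0 -ltNge.
  by rewrite -[X in _ / X](@sqr_sqrtr R)// expr2 invfM mulrA divff// mul1r.
set E := expR _; set c := _^-1.
transitivity (- (Num.sqrt 2 : R) ^+ 2 / 2 * x * (c * E)).
  by field.
by rewrite sqr_sqrtr// mulNr divff// mulN1r.
Qed.

(** From [expR (x ^+ 2 / 2) >= x ^+ 2 / 2] the function is at most [c * 2 / x] for positive [x]. *)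
Lemma cvg_mul_normal_pdf : x * phi x @[x --> +oo%R] --> (0 : R).
Proof.
pose c : R := (Num.sqrt (pi *+ 2))^-1.
apply: (@squeeze_cvgr _ _ _ _ (cst 0) (fun x => c * 2 * x^-1)).
- near=> x.
  have x0 : 0 < x by near: x; exact: nbhs_pinfty_gt.
  rewrite mulr_ge0 ?normal_pdf_ge0 ?(ltW x0)//=.
  rewrite normal_pdf_gauss_fun -/c -[c * 2 * _]mulrA [x * _]mulrCA.
  rewrite ler_wpM2l ?invr_ge0//.
  rewrite /gauss_fun expRN exprMn exprVn sqr_sqrtr//.
  rewrite ler_pdivrMr ?expR_gt0// mulrAC ler_pdivlMr// -expr2.
  rewrite mulrC -ler_pdivrMr//.
  by apply: le_trans (expR_ge1Dx _); rewrite lerDr.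
- exact: cvg_cst.
- rewrite -[X in _ --> X](mulr0 (c * 2)).
  apply: cvgM; first exact: cvg_cst.
  apply/gtr0_cvgV0; last exact: cvg_id.
  exact: nbhs_pinfty_gt.
Unshelve. all: by end_near. Qed.

(** The Gauss integral is known through the limit [pi / 4] of the square; [integral0_gauss], being
    nonnegative, is the root of its square. *)
Lemma cvg_integral0_gauss :
  @integral0_gauss R x @[x --> +oo%R] --> Num.sqrt pi / 2.
Proof.
have -> : Num.sqrt pi / 2 = Num.sqrt (pi / 4) :> R.
  rewrite sqrtrM ?pi_ge0// sqrtrV//; congr (_ / _).
  by rewrite (_ : 4 = 2 ^+ 2) ?sqrtr_sqr ?ger0_norm//; ring.
have -> : @integral0_gauss R = fun x => Num.sqrt (integral0_gauss x ^+ 2).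
  by apply/funext => x; rewrite sqrtr_sqr ger0_norm// integral0_gauss_ge0.
apply: continuous_cvg; [exact: sqrt_continuous|].
exact: cvg_integral0_gauss_sqr.
Qed.

Lemma derive_integral0_gauss (x : R) : 0 < x ->
  is_derive x 1 (@integral0_gauss R) (gauss_fun x).
Proof.
move=> x0.
(* Any bound beyond [x] would do: it makes [x] interior to a segment on which the integrand is
   integrable. *)
have xx1 : x < x + 1 by rewrite ltrDl.
have iI : mu.-integrable `[0, x + 1] (EFin \o @gauss_fun R).
  apply: continuous_compact_integrable; first exact: segment_compact.
  by apply: continuous_subspaceT; exact: continuous_gauss_fun.
have [dI <-] := continuous_FTC1_closed xx1 iI x0 (@continuous_gauss_fun R x).
by rewrite derive1E; exact: derivableP.
Qed.

Lemma integral_sqr_normal_pdf :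
  (\int[mu]_x (x ^+ 2 * phi x)%:E = 1)%E.
Proof.
pose c : R := (Num.sqrt (pi *+ 2))^-1.
have s20 : 0 < Num.sqrt 2 :> R by rewrite sqrtr_gt0.
have cphi : continuous phi by apply: continuous_normal_pdf; rewrite oner_neq0.
have cf : continuous (fun x : R => x ^+ 2 * phi x).
  by move=> x; apply: cvgM; [exact: exprn_continuous|exact: cphi].
rewrite ge0_symfun_integralT//; last 2 first.
- by move=> x; rewrite mulr_ge0 ?sqr_ge0 ?normal_pdf_ge0.
- by move=> x /=; rewrite normal_pdfN sqrrN.
rewrite -set_itvcy.
(* The first term of [F x] is the integral of [phi] over [0, x]. *)
pose F (x : R) := c * Num.sqrt 2 * integral0_gauss (x / Num.sqrt 2) - x * phi x.
have dF (x : R) : 0 < x -> is_derive x 1 F (x ^+ 2 * phi x).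
  move=> x0.
  have dI : is_derive (x / Num.sqrt 2) 1 (@integral0_gauss R)
      (gauss_fun (x / Num.sqrt 2)).
    by apply: derive_integral0_gauss; rewrite divr_gt0.
  have dphi := is_derive_normal_pdf x.
  apply: is_derive_eq.
  rewrite /GRing.scale/= !(mulr0, add0r, mulr1) normal_pdf_gauss_fun -/c.
  by field; rewrite gt_eqF.
have F0 : F 0 = 0.
  rewrite /F !mul0r subr0 /integral0_gauss set_itv1 Rintegral_set1.
  by rewrite mulr0.
(* At infinity [x * phi x] vanishes and the other term tends to [2^-1]; the factor 2 from the
   evenness of the integrand then gives 1. *)
rewrite (@ge0_continuous_FTC2y _ _ F 0 2^-1).
- by rewrite F0 sube0 -EFinM divff.
- by move=> x _; rewrite mulr_ge0 ?sqr_ge0 ?normal_pdf_ge0.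
- exact: continuous_subspaceT.
- rewrite (_ : 2^-1 = c * Num.sqrt 2 * (Num.sqrt pi / 2) - 0); last first.
    rewrite subr0 /c -[pi *+ 2]mulr_natr sqrtrM ?pi_ge0//; field.
    by rewrite !gt_eqF// sqrtr_gt0 pi_gt0.
  apply: cvgB; last exact: cvg_mul_normal_pdf.
  apply: cvgM; first exact: cvg_cst.
  apply: (cvg_comp (fun x => x / Num.sqrt 2)); last exact: cvg_integral0_gauss.
  by apply: gt0_cvgMly; [rewrite invr_gt0|exact: cvg_id].
- by move=> x /dF[].
(* [dF] covers only positive [x], so right continuity of [F] at 0 needs its own argument. *)
- rewrite F0 [X in _ --> X](_ : 0 = c * Num.sqrt 2 * 0 - 0 * phi 0); last first.
    by rewrite !(mulr0, mul0r) subrr.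
  apply: cvgB; last first.
    apply: cvg_at_right_filter.
    by apply: (@cvgM _ _ _ _ id phi); [exact: cvg_id|exact: cphi].
  apply: cvgM; first exact: cvg_cst.
  have I0 : integral0_gauss x @[x --> (0:R)] --> (0:R).
    apply: (@parameterized_integral_cvg_left R 0 1) => //.
    apply: continuous_compact_integrable; first exact: segment_compact.
    by apply: continuous_subspaceT; exact: continuous_gauss_fun.
  apply: cvg_at_right_filter.
  apply: (cvg_comp (fun x => x / Num.sqrt 2)); last exact: I0.
  rewrite [X in _ `=>` nbhs X](_ : 0 = 0 / Num.sqrt 2); last by rewrite mul0r.
  by apply: cvgM; [exact: cvg_id|exact: cvg_cst].
- by move=> x; rewrite in_itv/= andbT => /dF d; rewrite derive1E derive_val.
Qed.

Lemma normal_prob_moment2 :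
  (\int[normal_prob 0 1]_x (x ^+ 2)%:E = 1 :> \bar R)%E.
Proof.
rewrite ge0_integral_normal_prob//.
- by rewrite -integral_sqr_normal_pdf; apply: eq_integral => x _; rewrite EFinM.
- by apply/measurable_EFinP; exact: measurable_funX.
- by move=> x; rewrite lee_fin sqr_ge0.
Qed.

(** Both [phi] and Lebesgue measure are invariant under negation. *)
Lemma ge0_integral_normal_probN (f : R -> \bar R) :
    measurable_fun [set: R] f -> (forall x, 0 <= f x)%E ->
  (\int[normal_prob 0 1]_x f (- x)%R = \int[normal_prob 0 1]_x f x)%E.
Proof.
move=> mf f0; rewrite !ge0_integral_normal_prob//; last first.
  exact: measurableT_comp.
have mg : measurable_fun [set: R] (fun x => f x * (phi x)%:E)%E.
  by apply: emeasurable_funM => //; apply/measurable_EFinP;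
    exact: measurable_normal_pdf.
have mN : measurable_fun [set: R] (-%R : R -> measurableTypeR R).
  exact: oppr_measurable.
rewrite [RHS](eq_measure_integral
  (pushforward mu (-%R : _ -> measurableTypeR R))); last first.
  by move=> A mA _; exact/esym/lebesgue_measureN.
rewrite ge0_integral_pushforward//; last first.
  by move=> x _; rewrite mule_ge0// lee_fin normal_pdf_ge0.
by apply: eq_integral => x _; rewrite /= normal_pdfN.
Qed.

End normal_moments.

Section random_variables.
Context d (T : measurableType d) (R : realType) (P : probability T R).

(** * Standard normal random variables *)

Section standard_normal_rv.
Variable X : {RV P >-> R}.
Hypothesis nX : standard_normal X.

Lemma ge0_integral_standard_normal (f : R -> \bar R) :
    measurable_fun [set: R] f -> (forall x, 0 <= f x)%E ->
  (\int[P]_w f (X w) = \int[normal_prob 0 1]_x f x)%E.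
Proof.
move=> mf f0.
(* [normal_prob] lives on [measurableTypeR R], whose display differs from the
   one of [R] although the measurable sets are the same. *)
have mX : measurable_fun [set: T] (X : T -> measurableTypeR R).
  exact: (@measurable_funPT _ _ _ _ X).
rewrite (eq_measure_integral (pushforward P (X : T -> measurableTypeR R))).
  by rewrite ge0_integral_pushforward.
by move=> A mA _; exact/esym/nX.
Qed.

Lemma standard_normal_sqr : ('E_P[fun w => (X w ^+ 2)%R] = 1)%E.
Proof.
rewrite unlock -(@normal_prob_moment2 R).
rewrite (@ge0_integral_standard_normal (fun x => (x ^+ 2)%:E))//.
- by apply/measurable_EFinP; exact: measurable_funX.
- by move=> x; rewrite lee_fin sqr_ge0.
Qed.

Lemma standard_normal_sqr_Lfun1 : (fun w => X w ^+ 2) \in Lfun P 1.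
Proof.
apply/Lfun1_integrable/integrableP; split.
  by apply/measurable_EFinP; exact: measurable_funX.
under eq_integral do rewrite /= ger0_norm ?sqr_ge0//.
by have := standard_normal_sqr; rewrite unlock => ->; rewrite ltry.
Qed.

(** Integrability follows from the second moment, since [|x| <= 1 + x ^+ 2]. *)
Lemma standard_normal_Lfun1 : (X : T -> R) \in Lfun P 1.
Proof.
apply/Lfun1_integrable.
apply: (@le_integrable _ _ _ P setT measurableT _
    (fun w => (1 + X w ^+ 2)%:E)) => //.
- exact/measurable_EFinP.
- move=> w _ /=; rewrite lee_fin [leRHS]ger0_norm ?addr_ge0 ?sqr_ge0//.
  rewrite -real_normK ?num_real//; nra.
- under [X in integrable _ _ X]eq_fun do rewrite EFinD.
  apply: integrableD => //; first exact: finite_measure_integrable_cst.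
  exact/Lfun1_integrable/standard_normal_sqr_Lfun1.
Qed.

(** By symmetry of the law, the positive and negative parts of [X] have the same integral.
    Integrability makes this value finite, so that the difference is 0. *)
Lemma standard_normal_mean : ('E_P[X] = 0)%E.
Proof.
have mp : measurable_fun [set: R] (fun x => (Num.max x 0)%:E).
  by apply/measurable_EFinP; exact: measurable_maxr.
have p0 (x : R) : (0 <= (Num.max x 0)%:E)%E by rewrite lee_fin le_max lexx orbT.
rewrite unlock integralE.
rewrite [X in (X - _)%E](_ : _ =
    \int[normal_prob 0 1]_x (Num.max x 0)%:E)%E; last first.
  rewrite -ge0_integral_standard_normal//; apply: eq_integral => w _.
  by rewrite funeposE EFin_max.
rewrite [X in (_ - X)%E](_ : _ =
    \int[normal_prob 0 1]_x (Num.max (- x) 0)%:E)%E; last first.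
  rewrite -(@ge0_integral_standard_normal (fun x => (Num.max (- x) 0)%:E))//.
    by apply: eq_integral => w _; rewrite funenegE EFin_max.
  by apply: (measurableT_comp mp); exact: oppr_measurable.
rewrite (ge0_integral_normal_probN mp p0) subee//.
rewrite -ge0_integral_standard_normal//.
apply: integrable_fin_num => //.
have /Lfun1_integrable/(integrable_funepos measurableT) :=
  standard_normal_Lfun1.
by apply: eq_integrable => // w _; rewrite funeposE EFin_max.
Qed.

End standard_normal_rv.

(** Stated for bare functions, so that it applies directly to products of entries. *)
Definition independent_rv (X Y : T -> R) : Prop :=
  forall U V : set R, measurable U -> measurable V ->
    P (X @^-1` U `&` Y @^-1` V) = (P (X @^-1` U) * P (Y @^-1` V))%E.

(** * Products of two independent integrable variables *)

Section independent_product.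
Variables X Y : {RV P >-> R}.
Hypothesis XY : independent_rv X Y.

Let Z (w : T) : R * R := (X w, Y w).

Let mZ : measurable_fun [set: T] Z.
Proof. exact: measurable_fun_pair. Qed.

HB.instance Definition _ := isMeasurableFun.Build _ _ _ _ Z mZ.

(** Independence is the equality of both measures on rectangles, and these determine the product
    measure. *)
Let PZ (A : set (R * R)) : measurable A ->
  distribution P Z A = (distribution P X \x distribution P Y)%E A.
Proof.
move=> mA; apply/esym; exact: product_measure_unique.
Qed.

Let mmul : measurable_fun [set: R * R] (fun z => (z.1 * z.2)%:E).
Proof.
by apply/measurable_EFinP; apply: measurable_funM;
  [exact: measurable_fst|exact: measurable_snd].
Qed.

(** By Tonelli, the integral of [|x * y|] is the product of the first absolute moments of [X] and
    [Y]. *)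
Let prod_meas_integrable :
  (X : T -> R) \in Lfun P 1 -> (Y : T -> R) \in Lfun P 1 ->
  (distribution P X \x distribution P Y)%E.-integrable
    [set: R * R] (fun z => (z.1 * z.2)%:E).
Proof.
move=> /Lfun1_integrable/integrableP[_ iX] /Lfun1_integrable/integrableP[_ iY].
apply/integrable12ltyP => //=.
have mabs : measurable_fun [set: R] (fun x : R => `|x%:E|)%E.
  exact: measurableT_comp.
under eq_integral do under eq_integral do rewrite normrM EFinM.
under eq_integral do rewrite ge0_integralZl//.
rewrite ge0_integralZr//; last exact: integral_ge0.
rewrite !ge0_integral_distribution//.
have I0 (W : T -> R) : (0 <= \int[P]_w `|W w|%:E)%E.
  by apply: integral_ge0 => w _; rewrite lee_fin.
apply: lte_mul_pinfty; [exact: I0| |exact: iY].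
by rewrite ge0_fin_numE; [exact: iX|exact: I0].
Qed.

Let joint_law_integrable :
  (X : T -> R) \in Lfun P 1 -> (Y : T -> R) \in Lfun P 1 ->
  (distribution P Z).-integrable [set: R * R] (fun z => (z.1 * z.2)%:E).
Proof.
move=> iX iY; have /integrableP[_ iXY] := prod_meas_integrable iX iY.
apply/integrableP; split => //.
by rewrite (eq_measure_integral _ (fun A mA _ => PZ mA)).
Qed.

Lemma independent_rv_Lfun1M : (X : T -> R) \in Lfun P 1 ->
  (Y : T -> R) \in Lfun P 1 -> (fun w => X w * Y w) \in Lfun P 1.
Proof.
move=> iX iY.
have /integrableP[_ iXY] := joint_law_integrable iX iY.
apply/Lfun1_integrable/integrableP; split.
  exact: (measurableT_comp mmul mZ).
rewrite ge0_integral_distribution// in iXY.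
exact: measurableT_comp.
Qed.

Lemma independent_rv_expectationM : (X : T -> R) \in Lfun P 1 ->
  (Y : T -> R) \in Lfun P 1 ->
  ('E_P[fun w => (X w * Y w)%R] = 'E_P[X] * 'E_P[Y])%E.
Proof.
move=> iX iY; rewrite unlock.
have iXY := independent_rv_Lfun1M iX iY.
rewrite -[LHS](integral_distribution (X := Z) mmul); last first.
  exact/Lfun1_integrable.
rewrite (eq_measure_integral _ (fun A mA _ => PZ mA)).
rewrite -integral12_prod_meas1; last exact: prod_meas_integrable.
rewrite /fubini_F /=.
have idist (W : {RV P >-> R}) : (W : T -> R) \in Lfun P 1 ->
    (distribution P W).-integrable [set: R] EFin.
  by move=> /Lfun1_integrable iW; exact: integrable_pushforward.
under eq_integral do under eq_integral do rewrite EFinM.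
(* Finiteness lets the inner integral be written as a real constant, which can leave the outer
   integral. *)
have Yfin : (\int[distribution P Y]_y y%:E)%E \is a fin_num.
  by apply: integrable_fin_num => //; exact: idist.
under eq_integral => x _.
  rewrite integralZl//; last exact: idist.
  rewrite -(fineK Yfin).
  over.
rewrite integralZr//; last exact: idist.
rewrite fineK//; congr (_ * _)%E; rewrite integral_distribution//;
  exact/Lfun1_integrable.
Qed.

End independent_product.

(** * Finite sums and pairwise independence *)

Lemma Lfun1_sum (I : Type) (s : seq I) (f : I -> T -> R) :
  (forall i, f i \in Lfun P 1) -> (fun w => \sum_(i <- s) f i w) \in Lfun P 1.
Proof.
move=> fL; rewrite (_ : (fun w => _) = \sum_(i <- s) f i).
  by apply: rpred_sum => i _; exact: fL.
by apply/funext => w; rewrite fct_sumE.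
Qed.

Lemma expectation_sum_fun (I : Type) (s : seq I) (f : I -> T -> R) :
  (forall i, f i \in Lfun P 1) ->
  ('E_P[fun w => (\sum_(i <- s) f i w)%R] = \sum_(i <- s) 'E_P[f i])%E.
Proof.
(* [expectation_sum] runs over a list of functions, so the family is passed as the image of [s]
   under [f]. *)
move=> fL; rewrite -(big_map f xpredT (fun Y => 'E_P[Y]%E)) -expectation_sum.
  by congr expectation; apply/funext => w; rewrite big_map fct_sumE.
move=> Y; elim: s => // i s IH.
by rewrite inE => /orP[/eqP ->|]; [exact: fL|exact: IH].
Qed.

Lemma mutually_independent_pair (I : finType) (X : I -> {RV P >-> R})
    (i j : I) :
  mutually_independent X -> i != j -> independent_rv (X i) (X j).
Proof.
move=> indX ij U V mU mV.
(* Only the values of [W] at [i] and [j] matter, as the index set will be [{i, j}]. *)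
pose W k := if k == i then U else V.
have mW k : measurable (W k) by rewrite /W; case: ifP.
have := indX [set i; j]%SET W mW.
rewrite big_setU1 ?inE//= big_set1 /W eqxx eq_sym (negbTE ij) => <-.
congr (P _); apply/seteqP; split => w /=.
  move=> [Xi Xj] k /=; rewrite !inE => /orP[]/eqP->; rewrite ?eqxx//.
  by rewrite eq_sym (negbTE ij).
move=> XW; split.
  by have := XW i; rewrite /= !inE eqxx; exact.
by have := XW j; rewrite /= !inE eqxx orbT eq_sym (negbTE ij); exact.
Qed.

(** * Products of two entries of one matrix *)

Section iid_standard_normal_entries.
Variables (p q : nat) (A : random_matrix P p q).
Hypothesis hA : iid_standard_normal A.

Lemma iid_standard_normal_Lfun1M i j i' j' :
  (fun w => A i j w * A i' j' w) \in Lfun P 1.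
Proof.
have [[<- <-]|ij] := eqVneq (i, j) (i', j').
  by rewrite -[fun w => _]/(fun w => A i j w ^+ 2);
    exact: standard_normal_sqr_Lfun1 (hA.2 i j).
apply: independent_rv_Lfun1M; last 2 first.
- exact: standard_normal_Lfun1 (hA.2 i j).
- exact: standard_normal_Lfun1 (hA.2 i' j').
exact: (mutually_independent_pair hA.1 ij).
Qed.

Lemma iid_standard_normal_expectationM i j i' j' :
  ('E_P[fun w => (A i j w * A i' j' w)%R]
   = (((i, j) == (i', j'))%:R)%:E)%E.
Proof.
have [[<- <-]|ij] := eqVneq (i, j) (i', j').
  by rewrite -[fun w => _]/(fun w => A i j w ^+ 2)
    (standard_normal_sqr (hA.2 i j)).
rewrite independent_rv_expectationM; last 3 first.
- exact: (mutually_independent_pair hA.1 ij).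
- exact: standard_normal_Lfun1 (hA.2 i j).
- exact: standard_normal_Lfun1 (hA.2 i' j').
by rewrite (standard_normal_mean (hA.2 i j)) mul0e.
Qed.

End iid_standard_normal_entries.

(** With [T] carrying the sigma-algebra generated by [A], the entries are measurable by
    construction, and so are their products. *)
Lemma mx_sigma_algebra_entriesM (p q : nat) (A : random_matrix P p q) i j i' j'
    (U : set R) : measurable U ->
  mx_sigma_algebra A ((fun w => A i j w * A i' j' w) @^-1` U).
Proof.
pose G := [set E | exists i j, preimage_set_system setT (A i j) measurable E].
have mA k l : measurable_fun [set: g_sigma_algebraType G] (A k l).
  move=> _ V mV; apply: sub_sigma_algebra; exists k, l.
  by exists V.
move=> mU; rewrite -[_ @^-1` _]setTI.
exact: (measurable_funM (mA i j) (mA i' j') measurableT mU).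
Qed.

Lemma independent_mx_entriesM (p q p' q' : nat) (A : random_matrix P p q)
    (B : random_matrix P p' q') i j i' j' k l k' l' : independent_mx A B ->
  independent_rv (fun w => A i j w * A i' j' w) (fun w => B k l w * B k' l' w).
Proof.
by move=> AB U V mU mV; apply: AB; exact: mx_sigma_algebra_entriesM.
Qed.

(** * Second moment of an entry of the product matrix *)

Section product_entries.
Variables (m n r : nat) (A : random_matrix P m r) (B : random_matrix P r n).
Hypotheses (hA : iid_standard_normal A) (hB : iid_standard_normal B).
Hypothesis hAB : independent_mx A B.

(** The grouping separates [A] from [B], so that their independence splits the expectation. *)
Let crossterm i j k l w := (A i k w * A i l w) * (B k j w * B l j w).

Let crossterm_Lfun1 i j k l : crossterm i j k l \in Lfun P 1.
Proof.
apply: (@independent_rv_Lfun1M (A i k \* A i l) (B k j \* B l j)).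
- exact: independent_mx_entriesM.
- exact: iid_standard_normal_Lfun1M.
- exact: iid_standard_normal_Lfun1M.
Qed.

Let crossterm_expectation i j k l :
  ('E_P[crossterm i j k l] = ((k == l)%:R)%:E)%E.
Proof.
rewrite (@independent_rv_expectationM (A i k \* A i l) (B k j \* B l j)).
- rewrite !iid_standard_normal_expectationM// -EFinM -natrM mulnb.
  (* The row index [i] and the column index [j] are shared, so both indicators reduce to
     [k == l]. *)
  by rewrite !xpair_eqE !eqxx andbT andbb.
- exact: independent_mx_entriesM.
- exact: iid_standard_normal_Lfun1M.
- exact: iid_standard_normal_Lfun1M.
Qed.

Let sqr_product_entryE i j : (fun w => (\sum_k A i k w * B k j w) ^+ 2) =
  (fun w => \sum_k \sum_l crossterm i j k l w).
Proof.
apply/funext => w; rewrite expr2 mulr_suml; apply: eq_bigr => k _.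
by rewrite mulr_sumr; apply: eq_bigr => l _; rewrite /crossterm mulrACA.
Qed.

Lemma expectation_sqr_product_entry i j :
  ('E_P[fun w => ((\sum_k A i k w * B k j w) ^+ 2)%R] = (r%:R)%:E)%E.
Proof.
rewrite sqr_product_entryE expectation_sum_fun => [|k]; last exact: Lfun1_sum.
rewrite (eq_bigr (fun=> 1%E)) => [|k _].
  by rewrite sumEFin sumr_const card_ord.
rewrite expectation_sum_fun//.
rewrite (bigD1 k)//= crossterm_expectation eqxx big1 ?adde0// => l lk.
by rewrite crossterm_expectation eq_sym (negbTE lk).
Qed.

Lemma sqr_product_entry_Lfun1 i j :
  (fun w => (\sum_k A i k w * B k j w) ^+ 2) \in Lfun P 1.
Proof.
by rewrite sqr_product_entryE; apply: Lfun1_sum => k; exact: Lfun1_sum.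
Qed.

End product_entries.

End random_variables.

(** * Summation over the entries of the product *)

Lemma sqr_frobenius_norm (R : realType) (p q : nat) (M : 'M[R]_(p, q)) :
  frobenius_norm M ^+ 2 = \sum_i \sum_j M i j ^+ 2.
Proof.
rewrite sqr_sqrtr; last first.
  by do 2 (apply: sumr_ge0 => ? _); exact: sqr_ge0.
by do 2 (apply: eq_bigr => ? _); rewrite real_normK ?num_real.
Qed.

Theorem proposition26 (d : measure_display) (T : measurableType d)
    (R : realType) (P : probability T R) (m n r : nat)
    (A : random_matrix P m r) (B : random_matrix P r n)
    (hA : iid_standard_normal A) (hB : iid_standard_normal B)
    (hAB : independent_mx A B) :
  'E_P[fun w : T => (frobenius_norm (mx_value A w *m mx_value B w)%R ^+ 2)%R]%E
    = ((m * n * r)%N%:R%R)%:E%E.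
Proof.
rewrite (_ : (fun w => _) =
    (fun w => \sum_i \sum_j (\sum_k A i k w * B k j w) ^+ 2)); last first.
  apply/funext => w; rewrite sqr_frobenius_norm.
  apply: eq_bigr => i _; apply: eq_bigr => j _; rewrite mxE.
  by congr (_ ^+ 2); apply: eq_bigr => k _; rewrite !mxE.
have L i j := sqr_product_entry_Lfun1 hA hB hAB i j.
rewrite expectation_sum_fun => [|i]; last exact: Lfun1_sum.
rewrite (eq_bigr (fun=> ((n * r)%:R)%:E)) => [|i _].
  by rewrite sumEFin sumr_const card_ord -mulrnA mulnC mulnA.
rewrite expectation_sum_fun//.
rewrite (eq_bigr (fun=> (r%:R)%:E)) => [|j _].
  by rewrite sumEFin sumr_const card_ord -mulrnA mulnC.
exact: expectation_sqr_product_entry.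
Qed.
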